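(* Let $e\in KG$ be an idempotent, and let $\rho_e:KG\to KG$ be the $FG$-linear projector defined by $\rho_e(x)=xe$. Let $\star\in\{\mathrm{TE},\mathrm{TH}\}$, where the case $\star=\mathrm{TH}$ is considered only when $m$ is even. Then the following conditions are equivalent: (1) The restricted idempotent additive left group code $FGe=\rho_e(FG)\subseteq KG$ is $\star$-self-dual. (2) For all $x,y\in FG$, one has $\langle xe,ye\rangle_\star=0$, and $\dim_F(FGe)=\frac12\dim_F(KG)$. (3) The form $\widetilde{B}_e:FG\times FG\to F$ defined by $\widetilde{B}_e(x,y)=\langle xe,ye\rangle_\star$ induces a well-defined form $\overline{B}_e:(FG/\ker(\rho_e|_{FG}))\times(FG/\ker(\rho_e|_{FG}))\to F$ given by $\overline{B}_e(x+\ker(\rho_e|_{FG}),\,y+\ker(\rho_e|_{FG}))=\langle xe,ye\rangle_\star$; moreover, $\overline{B}_e$ is the zero form, and $\dim_F(FGe)=\frac12\dim_F(KG)$. (4) If $x_1,\dots,x_n$ is any $F$-basis of $FG$ and $M_e=\bigl(\langle x_ie,x_je\rangle_\star\bigr)_{1\le i,j\le n}$, then $M_e=0$, and moreover $\dim_F(FGe)=\frac12\dim_F(KG)$.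
   Context: $F=\mathbb{F}_q$ is a finite field, $K=\mathbb{F}_{q^m}$ is its extension of degree $m$, $G$ is a finite group of order $n$, and $FG\subseteq KG$ are the group algebras. An additive left group code is a left $FG$-submodule $C\leq KG$. For $x=\sum_{g\in G}a_g g$ and $y=\sum_{g\in G}b_g g$ in $KG$, $\langle x,y\rangle_{\mathrm{TE}}=\operatorname{Tr}_{K/F}\left(\sum_{g\in G}a_gb_g\right)$ and, when $m$ is even, $\langle x,y\rangle_{\mathrm{TH}}=\operatorname{Tr}_{K/F}\left(\sum_{g\in G}a_g\overline{b_g}\right)$, where $\overline{b}=b^{q^{m/2}}$. For a code $C$, $C^{\perp_\star}=\{x\in KG:\langle x,c\rangle_\star=0\text{ for all }c\in C\}$ (taken in the ambient space $KG$), and $C$ is $\star$-self-dual if $C=C^{\perp_\star}$. For an idempotent $e\in KG$, $FGe=\{xe:x\in FG\}$ is called the restricted idempotent additive left group code associated with $e$; $\ker(\rho_e|_{FG})=\{x\in FG:xe=0\}$. *)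

(* Defs.v *)
From HB Require Import structures.
From mathcomp Require Import all_boot all_order all_fingroup all_algebra all_field.

Set Implicit Arguments.
Unset Strict Implicit.
Unset Printing Implicit Defensive.

Import GRing.Theory.
Local Open Scope ring_scope.

(* [{ffun gT -> A}] already carries the pointwise product; the alias [grpalg]
   carries the convolution product instead. *)
Definition grpalg (gT : finGroupType) (A : Type) : predArgType :=
  {ffun gT -> A}.

Section GroupRing.
Variables (gT : finGroupType) (A : nzRingType).
Local Notation AG := (grpalg gT A).
Implicit Types x y z : AG.

HB.instance Definition _ := GRing.Zmodule.copy AG {ffun gT -> A}.

Definition grpalg_one : AG := [ffun g => (g == 1%g)%:R].
Definition grpalg_mul x y : AG := [ffun g => \sum_h x h * y (h^-1 * g)%g].

Fact grpalg_mulA : associative grpalg_mul.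
Proof.
move=> x y z; apply/ffunP=> g; rewrite !ffunE.
under eq_bigr do rewrite ffunE mulr_sumr.
under [RHS]eq_bigr do rewrite ffunE mulr_suml.
rewrite [RHS]exchange_big; apply: eq_bigr => h _ /=.
rewrite (reindex_inj (mulgI h^-1%g)) /=; apply: eq_bigr => k _.
by rewrite mulrA invMg invgK mulgA mulgK.
Qed.

Fact grpalg_mul1l : left_id grpalg_one grpalg_mul.
Proof.
move=> x; apply/ffunP=> g; rewrite !ffunE (bigD1 1%g) //= ffunE eqxx mul1r.
rewrite invg1 mul1g big1 ?addr0 // => h /negPf h1.
by rewrite ffunE h1 mul0r.
Qed.

Fact grpalg_mul1r : right_id grpalg_one grpalg_mul.
Proof.
move=> x; apply/ffunP=> g; rewrite !ffunE (bigD1 g) //= ffunE mulVg eqxx mulr1.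
rewrite big1 ?addr0 // => h hg; rewrite ffunE -eq_mulVg1 (negPf hg).
by rewrite mulr0.
Qed.

Fact grpalg_mulDl : left_distributive grpalg_mul +%R.
Proof.
move=> x y z; apply/ffunP=> g; rewrite !ffunE -big_split.
by apply: eq_bigr => h _; rewrite ffunE mulrDl.
Qed.

Fact grpalg_mulDr : right_distributive grpalg_mul +%R.
Proof.
move=> x y z; apply/ffunP=> g; rewrite !ffunE -big_split.
by apply: eq_bigr => h _; rewrite ffunE mulrDr.
Qed.

Fact grpalg_oner_neq0 : grpalg_one != 0.
Proof.
by apply/eqP=> /ffunP/(_ 1%g)/eqP; rewrite !ffunE eqxx oner_eq0.
Qed.

HB.instance Definition _ := GRing.Zmodule_isNzRing.Build AG
  grpalg_mulA grpalg_mul1l grpalg_mul1r grpalg_mulDl grpalg_mulDr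
  grpalg_oner_neq0.

End GroupRing.

Section GroupAlgebra.
Variables (gT : finGroupType) (F : fieldType) (A : falgType F).
Local Notation AG := (grpalg gT A).

HB.instance Definition _ := Vector.copy AG {ffun gT -> A}.

Fact grpalg_scaleAl (a : F) (x y : AG) : a *: (x * y) = (a *: x) * y.
Proof.
apply/ffunP=> g; rewrite !ffunE scaler_sumr.
by apply: eq_bigr => h _; rewrite ffunE scalerAl.
Qed.

HB.instance Definition _ := GRing.Lmodule_isLalgebra.Build F AG grpalg_scaleAl.

Fact grpalg_scaleAr (a : F) (x y : AG) : a *: (x * y) = x * (a *: y).
Proof.
apply/ffunP=> g; rewrite !ffunE scaler_sumr.
by apply: eq_bigr => h _; rewrite ffunE scalerAr.
Qed.

HB.instance Definition _ := GRing.Lalgebra_isAlgebra.Build F AG grpalg_scaleAr.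
HB.instance Definition _ := Algebra_isFalgebra.Build F AG.

(* The inclusion of FG in AG; [F^o] is F viewed as an F-algebra. *)
Definition grpalg_incl (x : grpalg gT F^o) : AG := [ffun g => (x g)%:A].

Fact grpalg_incl_linear : linear grpalg_incl.
Proof.
by move=> a x y; apply/ffunP=> g; rewrite !ffunE scalerDl scalerA.
Qed.

HB.instance Definition _ := GRing.isLinear.Build F (grpalg gT F^o) AG _
  grpalg_incl grpalg_incl_linear.

Fact grpalg_incl_monoid_morphism : monoid_morphism grpalg_incl.
Proof.
split=> [|x y]; apply/ffunP=> g; rewrite !ffunE.
  by case: eqP => _; rewrite ?scale1r ?scale0r.
rewrite scaler_suml; apply: eq_bigr => h _.
by rewrite !ffunE mulr_algl scalerA.
Qed.

HB.instance Definition _ := GRing.isMonoidMorphism.Build (grpalg gT F^o) AG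
  grpalg_incl grpalg_incl_monoid_morphism.

Lemma grpalg_incl_inj : injective grpalg_incl.
Proof.
move=> x y /ffunP eqxy; apply/ffunP=> g; move/eqP: (eqxy g); rewrite !ffunE.
by rewrite -subr_eq0 -scalerBl scaler_eq0 oner_eq0 orbF subr_eq0 => /eqP.
Qed.

End GroupAlgebra.

Section Trace.
Variables (F : finFieldType) (K : fieldExtType F).

(* [galTrace] is K-valued and lands in the line [1%VS]; taking the
   coordinate along 1 makes it F-valued. *)
Definition trace (a : K) : F :=
  let L := FinSplittingFieldType F K in
  coord [tuple (1 : L)] ord0 (galTrace 1 {:L} (a : L)).

Lemma traceE (a : K) :
  (trace a)%:A = galTrace 1 {:FinSplittingFieldType F K} a :> K.
Proof.
rewrite /trace; set L := FinSplittingFieldType F K.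
set t := galTrace _ _ _.
have : t \in 1%VS.
  by apply: mem_galTrace; rewrite ?memvf ?finField_galois ?sub1v.
rewrite -span_seq1 => /(@coord_span _ _ _ [tuple (1 : L)]).
by rewrite big_ord1 => {2}->.
Qed.

End Trace.

Section Codes.
Variables (F : finFieldType) (K : fieldExtType F) (gT : finGroupType).
Local Notation KG := (grpalg gT K).
Local Notation FG := (grpalg gT F^o).

Variant ip_kind := TE | TH.

(* The conjugation of K over its subfield of index 2; only meaningful when
   [\dim {:K}] is even. *)
Definition conjK (b : K) : K := b ^+ (#|F| ^ (\dim {:K})./2).

Definition ip (star : ip_kind) (x y : KG) : F :=
  match star with
  | TE => trace (\sum_g x g * y g)
  | TH => trace (\sum_g x g * conjK (y g))
  end.

(* As F is contained in FG, left FG-submodules of KG are in particular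
   F-subspaces, whence the type of C. *)
Definition additive_left_group_code (C : {vspace KG}) : Prop :=
  forall (a : FG) (c : KG), c \in C -> grpalg_incl K a * c \in C.

Definition dual (star : ip_kind) (C : {vspace KG}) (x : KG) : Prop :=
  forall c, c \in C -> ip star x c = 0.

Definition self_dual (star : ip_kind) (C : {vspace KG}) : Prop :=
  forall x, x \in C <-> dual star C x.

(* The restriction to FG of the projector [amulr e : x |-> x * e]. *)
Definition rho_restr (e : KG) : 'Hom(FG, KG) :=
  (amulr e \o linfun (@grpalg_incl gT F K))%VF.

Definition ker_rho (e : KG) : {vspace FG} := lker (rho_restr e).

Definition FGe (e : KG) : {vspace KG} := limg (rho_restr e).

Lemma rho_restrE (e : KG) (x : FG) : rho_restr e x = grpalg_incl K x * e.
Proof. by rewrite comp_lfunE lfunE /= lfunE. Qed.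

Lemma mem_ker_rho (e : KG) (x : FG) :
  (x \in ker_rho e) = (grpalg_incl K x * e == 0).
Proof. by rewrite memv_ker rho_restrE. Qed.

Lemma FGe_code (e : KG) : additive_left_group_code (FGe e).
Proof.
move=> a _ /memv_imgP[x _ ->]; apply/memv_imgP; exists (a * x).
  exact: memvf.
by rewrite !rho_restrE rmorphM mulrA.
Qed.

End Codes.

(* Main.v *)
(* The forms TE and TH are F-bilinear and nondegenerate, because the trace of
   K / F is not identically zero and b |-> b ^+ (q ^ k) is F-linear with trivial
   kernel. Hence C and its dual have complementary dimensions in KG, so that C
   is self-dual iff it is isotropic and of half dimension. For C = FGe,
   isotropy can be tested on pairs (xe, ye), and by bilinearity on a basis. *)
Require Import Defs.
From HB Require Import structures.
From mathcomp Require Import all_boot all_order all_fingroup all_algebra all_field.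

Set Implicit Arguments.
Unset Strict Implicit.
Unset Printing Implicit Defensive.

Import GRing.Theory Quotient.
Local Open Scope ring_scope.
Local Open Scope quotient_scope.

Section BilinearForm.
Variables (F : fieldType) (V : vectType F) (B : V -> V -> F).
Hypotheses (Bl : forall y, scalar (B^~ y)) (Br : forall x, scalar (B x)).

Lemma form_suml y (I : Type) (r : seq I) (a : I -> F) (v : I -> V) :
  B (\sum_(i <- r) a i *: v i) y = \sum_(i <- r) a i * B (v i) y.
Proof.
elim/big_rec2: _ => [|i b u _ <-]; last by rewrite Bl.
(* The empty sum: linearity at [-1], [0], [0] reads B 0 y = - B 0 y + B 0 y, hence B 0 y = 0. *)
by have := Bl y (-1) 0 0; rewrite scaler0 addr0 mulN1r addNr.
Qed.

Lemma form_sumr x (I : Type) (r : seq I) (a : I -> F) (v : I -> V) :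
  B x (\sum_(i <- r) a i *: v i) = \sum_(i <- r) a i * B x (v i).
Proof.
elim/big_rec2: _ => [|i b u _ <-]; last by rewrite Br.
by have := Br x (-1) 0 0; rewrite scaler0 addr0 mulN1r addNr.
Qed.

(** [D] is the kernel of the map [phi] pairing x with each vector of a basis of [C]. Nondegeneracy
    makes [phi] surjective, and rank-nullity gives the dimensions. *)
Lemma dim_left_orthogonal (C : {vspace V}) :
    (forall y, (forall x, B x y = 0) -> y = 0) ->
  exists2 D : {vspace V},
    (forall x, x \in D <-> forall c, c \in C -> B x c = 0) &
    (\dim D + \dim C = \dim {:V})%N.
Proof.
move=> Bnd; pose c := vbasis C; have cC := vbasisP C.
pose phi x := \row_i B x (tnth c i).
have phi_lin : linear phi.
  by move=> a x y; apply/rowP=> i; rewrite !mxE Bl.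
pose phiM := GRing.isLinear.Build _ _ _ _ phi phi_lin.
pose phiL : {linear V -> 'rV_(\dim C)} := HB.pack phi phiM.
exists (lker (linfun phiL)) => [x|].
  rewrite memv_ker lfunE /=; split=> [/eqP/rowP phix0 y yC|x0].
    rewrite (coord_basis cC yC) form_sumr big1 // => i _.
    by have := phix0 i; rewrite !mxE (tnth_nth 0) => ->; rewrite mulr0.
  by apply/eqP/rowP=> i; rewrite !mxE x0 // (basis_mem cC) ?mem_tnth.
rewrite -[RHS](limg_ker_dim (linfun phiL)) capfv; congr addn.
set W := limg _; pose r := \dim W; pose w := vbasis W.
(* A non-surjective [phi] would have its image in the kernel of a nonzero
   functional [v], making [\sum_i v i *: c_i] right orthogonal to V. *)
have leWC : (\dim W <= \dim C)%N.
  by have := dimvS (subvf W); rewrite [X in (_ <= X)%N]dimvf /dim /= mul1n.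
apply/eqP; rewrite eqn_leq leWC andbT leqNgt; apply/negP => ltWC.
pose A := \matrix_(i < r) (tnth w i : 'rV_(\dim C)).
have /rowV0Pn[v /sub_kermxP vA v0] : kermx A^T != 0.
  rewrite -mxrank_eq0 mxrank_ker subn_eq0 -ltnNge.
  by apply: leq_ltn_trans ltWC; rewrite rank_leq_col.
have phiv x : phi x *m v^T = 0.
  have /(coord_basis (vbasisP W)) : phi x \in W.
    by rewrite -[phi x](lfunE phiL) memv_img ?memvf.
  move=> ->; rewrite mulmx_suml big1 // => i _; rewrite -scalemxAl.
  have -> : (vbasis W)`_i = row i A by rewrite rowK (tnth_nth 0).
  by rewrite -row_mul -[A]trmxK -trmx_mul vA trmx0 row0 scaler0.
have c0 : \sum_i v 0 i *: c`_i = 0.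
  apply: Bnd => x; rewrite form_sumr; have /matrixP/(_ 0 0) := phiv x.
  rewrite !mxE => {2}<-; apply: eq_bigr => i _.
  by rewrite !mxE (tnth_nth 0) mulrC.
case/eqP: v0; apply/rowP=> i; rewrite mxE.
by have /freeP/(_ (v 0) c0) := basis_free cC.
Qed.

End BilinearForm.

Section InnerProduct.
Variables (F : finFieldType) (K : fieldExtType F) (gT : finGroupType).
Local Notation KG := (grpalg gT K).

Lemma trace_scalar : scalar (@trace F K).
Proof.
move=> a x y; rewrite /trace; set L := FinSplittingFieldType F K.
rewrite -linearP; congr (coord _ _ _).
rewrite /galTrace scaler_sumr -big_split; apply: eq_bigr => s _.
exact: (linearP (s : 'End(L))).
Qed.

(** Independence of the automorphisms of K / F: their sum, with all coefficients 1, is not the zero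
    map. *)
Lemma trace_neq0 : exists a : K, trace a != 0.
Proof.
pose L := FinSplittingFieldType F K.
have [a _ nz] := @gal_independent_contra F L {:L}
  [in 'Gal({:L} / 1)%g] (fun=> 1) _ (group1 _) (oner_neq0 _).
exists a; apply: contraNneq nz => tr0.
have := @traceE F K a; rewrite tr0 scale0r => trE.
by apply/eqP; rewrite [RHS]trE; apply: eq_bigr => s _; rewrite mul1r.
Qed.

(** This holds for any exponent q ^ k with q = #|F|: it is a power of the characteristic, whence
    additivity, and a ^+ q = a on F, whence homogeneity. *)
Lemma conjK_linear : linear (@conjK F K).
Proof.
move=> a x y; rewrite /conjK; move: _./2 => k.
have [p p_pr pF] := finPcharP F.
rewrite exprDn_pchar; last first.
  rewrite (card_pprimeChar pF) -expnM pnatX; apply/orP; left.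
  by rewrite pnatE // (pchar_lalg K).
congr (_ + _); rewrite exprZn; congr (_ *: _).
by elim: k => // k IHk; rewrite expnS exprM expf_card.
Qed.

Lemma ip_scalar_l star (y : KG) : scalar (ip star ^~ y).
Proof.
move=> a x z; case: star => /=; rewrite -trace_scalar; congr trace;
  rewrite scaler_sumr -big_split; apply: eq_bigr => g _;
  by rewrite !ffunE mulrDl scalerAl.
Qed.

Lemma ip_scalar_r star (x : KG) : scalar (ip star x).
Proof.
move=> a y z; case: star => /=; rewrite -trace_scalar; congr trace;
  rewrite scaler_sumr -big_split; apply: eq_bigr => g _;
  by rewrite !ffunE ?conjK_linear mulrDr scalerAr.
Qed.

Lemma ip_nondegenerate star (y : KG) : (forall x, ip star x y = 0) -> y = 0.
Proof.
move=> y0; apply/ffunP=> g; rewrite ffunE; apply/eqP/negPn/negP => yg.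
have [a /negP[]] := trace_neq0.
(* Supported at g alone, [x b] pairs with y to the trace of b times [y g] or its conjugate. Dividing
   [a] by that nonzero factor makes the pairing equal to [trace a], which is nonzero. *)
pose x b : KG := [ffun h => if h == g then b else 0].
have xE (b : K) (z : gT -> K) : \sum_h x b h * z h = b * z g.
  rewrite (bigD1 g) //= big1 ?addr0 ?ffunE ?eqxx // => h /negPf hg.
  by rewrite ffunE hg mul0r.
case: star y0 => /= y0.
  by have := y0 (x (a / y g)); rewrite xE divfK // => ->.
have conj_yg : conjK (y g) != 0 by rewrite expf_neq0.
by have := y0 (x (a / conjK (y g))); rewrite xE divfK // => ->.
Qed.

End InnerProduct.

Theorem theorem3p33 (F : finFieldType) (K : fieldExtType F)
    (gT : finGroupType) (e : grpalg gT K) (he : e * e = e)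
    (star : ip_kind) (hstar : star = TH -> ~~ odd (\dim {:K})) :
  let KG := grpalg gT K in
  let FG := grpalg gT F^o in
  let n := #|gT| in
  let rho (x : FG) : KG := grpalg_incl K x * e in
  let half_dim := (2 * \dim (FGe e) = \dim {:KG})%N in
  [<->
    self_dual star (FGe e);
    (forall x y : FG, ip star (rho x) (rho y) = 0) /\ half_dim;
    (exists Bbar : {quot (ker_rho e)} -> {quot (ker_rho e)} -> F,
       (forall x y : FG,
          Bbar (\pi x) (\pi y) = ip star (rho x) (rho y)) /\
       (forall u v, Bbar u v = 0)) /\ half_dim;
    (forall x : n.-tuple FG, basis_of {:FG} x ->
       \matrix_(i < n, j < n) ip star (rho (tnth x i)) (rho (tnth x j)) = 0)
    /\ half_dim].
Proof.
move=> KG FG n rho half_dim.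
have dimFG : \dim {:FG} = n by rewrite dimvf [LHS]muln1.
(* [D] is the dual of [FGe e] as a subspace, so that it has a dimension. *)
have [D memD dimD] := dim_left_orthogonal (ip_scalar_l star)
  (ip_scalar_r star) (FGe e) (@ip_nondegenerate _ _ _ star).
have memFGe x : x \in FGe e <-> exists y, x = rho y.
  split=> [/memv_imgP[y _ ->]|[y ->]]; first by exists y; rewrite rho_restrE.
  by rewrite /rho -rho_restrE memv_img ?memvf.
tfae=> [sd | [B0 ?] | [[Bbar [BbarE Bbar0]] ?] | [M0 hd]].
- split=> [x y|]; first by apply: ((sd (rho x)).1); apply/memFGe; eexists.
  suffices eD : FGe e = D by rewrite /half_dim mul2n -addnn -dimD -eD.
  by apply/vspaceP=> x; apply/idP/idP => [/sd/memD | /memD/sd].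
(* By isotropy the zero form on the quotient already has the prescribed values on classes. *)
- by split=> //; exists (fun _ _ => 0); split.
- by split=> // x _; apply/matrixP=> i j; rewrite !mxE -BbarE Bbar0.
(* It remains to go from (4) back to (1); a single basis of FG suffices to recover isotropy. *)
have [x bx] : exists x : n.-tuple FG, basis_of {:FG} x.
  by rewrite -dimFG; exists (vbasis {:FG}); apply: vbasisP.
have rhoE y : rho y = \sum_(i < n) coord x i y *: rho (tnth x i).
  rewrite {1}(coord_basis bx (memvf y)) /rho linear_sum mulr_suml.
  by apply: eq_bigr => i _; rewrite linearZ -scalerAl (tnth_nth 0).
have iso y z : ip star (rho y) (rho z) = 0.
  rewrite [rho y]rhoE [rho z]rhoE (form_suml (ip_scalar_l star)) big1 // => i _.
  rewrite (form_sumr (ip_scalar_r star)) big1 ?mulr0 // => j _.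
  by have /matrixP/(_ i j) := M0 x bx; rewrite !mxE => ->; rewrite mulr0.
have sCD : (FGe e <= D)%VS.
  by apply/subvP=> _ /memFGe[y ->]; apply/memD => _ /memFGe[z ->].
(* Given the inclusion, dim D <= dim FGe is enough; adding dim FGe to both sides turns it into dim
   KG <= 2 dim FGe. *)
have eD : FGe e = D.
  apply/eqP; rewrite eqEdim sCD -(leq_add2r (\dim (FGe e))) dimD -hd.
  by rewrite mul2n addnn leqnn.
by move=> y; rewrite {1}eD; exact: memD.
Qed.
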